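(* Let $G$ be an $(r,s)$-directed hypergraph with at least one arc, and let $p,q\ge1$ be real numbers with $r/p+s/q<1$. Then the function $x\mapsto x\log\lambda_{px,qx}(G)$ is concave upward (convex) on the interval $(r/p+s/q,\infty)$.
   Context: Let $r,s$ be positive integers. An $(r,s)$-directed hypergraph $G$ consists of a finite vertex set $V(G)$ and a finite set $E(G)$ of arcs. Each arc $e$ is an ordered pair $(T(e),H(e))$ of disjoint subsets of $V(G)$ (tail and head) with $|T(e)|=r$ and $|H(e)|=s$. Write $T(G)=\bigcup_eT(e)$ and $H(G)=\bigcup_eH(e)$. For real vectors $\mathbf{x}=(x_u)_{u\in T(G)}$ and $\mathbf{y}=(y_v)_{v\in H(G)}$, indexed independently, set $P_G(\mathbf x,\mathbf y)=\sum_{e\in E(G)}\prod_{u\in T(e)}x_u\prod_{v\in H(e)}y_v$. For real $p,q\ge1$ let $\lambda_{p,q}(G)=\max\{P_G(\mathbf x,\mathbf y):\|\mathbf x\|_p=\|\mathbf y\|_q=1\}$. *)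

(* Defs.v *)
From HB Require Import structures.
From mathcomp Require Import all_boot all_order all_algebra.
From mathcomp Require Import all_classical all_reals all_analysis.
Set Implicit Arguments.
Unset Strict Implicit.
Unset Printing Implicit Defensive.
Import Order.TTheory GRing.Theory Num.Theory.
Import numFieldNormedType.Exports.
Local Open Scope ring_scope.

Record dhypergraph (r s : nat) := DHypergraph {
  vertex :> finType;
  arcs : {set {set vertex} * {set vertex}};
  arcsP : forall e, e \in arcs ->
    [/\ [disjoint e.1 & e.2], #|e.1| = r & #|e.2| = s]
}.

Section DHypergraph.
Variables (r s : nat) (G : dhypergraph r s).

Definition tails : {set G} := (\bigcup_(e in arcs G) e.1)%SET.
Definition heads : {set G} := (\bigcup_(e in arcs G) e.2)%SET.

Definition tail_vertex : finType := {u : G | u \in tails}.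
Definition head_vertex : finType := {v : G | v \in heads}.

Variable R : realType.

(* The inner products range over all of T(e) and H(e), since T(e) and H(e)    *)
(* are contained in [tails] and [heads] for every arc e.                      *)
Definition polyform (x : tail_vertex -> R) (y : head_vertex -> R) : R :=
  \sum_(e in arcs G)
    (\prod_(u : tail_vertex | val u \in e.1) x u) *
    (\prod_(v : head_vertex | val v \in e.2) y v).

Definition pnorm (I : finType) (p : R) (x : I -> R) : R :=
  (\sum_i `|x i| `^ p) `^ p^-1.

Local Open Scope classical_set_scope.

Definition polyform_values (p q : R) : set R :=
  [set z | exists x y, [/\ pnorm p x = 1, pnorm q y = 1 & z = polyform x y]].

(* The supremum is a maximum when r, s > 0, G has an arc and p, q >= 1: see   *)
(* [lambda_attained] and [lambda_ub].                                         *)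
Definition lambda (p q : R) : R := sup (polyform_values p q).

End DHypergraph.

Arguments polyform {r s} G {R} x y.

Section Attained.
Local Open Scope classical_set_scope.
Variable R : realType.

Lemma cvg_norm_powR (p a : R) : 0 < p ->
  `|x| `^ p @[x --> a] --> `|a| `^ p.
Proof.
move=> p0; have [->|a0] := eqVneq a 0.
  rewrite normr0 powR0 ?gt_eqF//; apply/cvgr0Pnorm_lt => /= e e0.
  have d0 : 0 < e `^ p^-1 by exact: powR_gt0.
  near=> x.
  rewrite ger0_norm ?powR_ge0//.
  have xd : `|x| < e `^ p^-1 by near: x; apply: (cvgr0_norm_lt (fun x : R => x)) => //.
  have := @gt0_ltr_powR R p p0 `|x| (e `^ p^-1).
  rewrite !nnegrE normr_ge0 powR_ge0 => /(_ isT isT xd).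
  by rewrite -powRrM mulVf ?gt_eqF// powRr1// ltW.
apply: (@continuous_comp _ _ _ (fun x : R => `|x|) (fun y => y `^ p)).
  exact: norm_continuous.
apply: differentiable_continuous; apply/derivable1_diffP.
by apply: derivable_powR; rewrite in_itv/= andbT normr_gt0.
Unshelve. all: by end_near. Qed.

Definition sphere_p (I : finType) (p : R) : set {ptws I -> R} :=
  [set x | pnorm p x = 1].

Lemma pnorm_eq1 (I : finType) (p : R) (x : I -> R) : 0 < p ->
  (pnorm p x = 1) <-> (\sum_i `|x i| `^ p = 1).
Proof.
move=> p0; rewrite /pnorm; split=> [h|->]; last by rewrite powR1.
have S0 : 0 <= \sum_i `|x i| `^ p by apply: sumr_ge0 => i _; exact: powR_ge0.
have := congr1 (fun y => y `^ p) h.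
by rewrite -powRrM mulVf ?gt_eqF// powRr1// powR1.
Qed.

Lemma cvg_sum_fin (T : topologicalType) (I : finType) (P : pred I)
    (f : I -> T -> R) (a : T) :
  (forall i, P i -> f i x @[x --> a] --> f i a) ->
  \sum_(i | P i) f i x @[x --> a] --> \sum_(i | P i) f i a.
Proof. by move=> h; apply: cvg_big => //; exact: add_continuous. Qed.

Lemma cvg_prod_fin (T : topologicalType) (I : finType) (P : pred I)
    (f : I -> T -> R) (a : T) :
  (forall i, P i -> f i x @[x --> a] --> f i a) ->
  \prod_(i | P i) f i x @[x --> a] --> \prod_(i | P i) f i a.
Proof. by move=> h; apply: cvg_big => //; exact: mul_continuous. Qed.

Lemma ptws_cvg (I : choiceType) (i : I) (a : {ptws I -> R}) :
  (x : {ptws I -> R}) i @[x --> a] --> (a i : R).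
Proof. exact: (@proj_continuous I (fun=> R) i a). Qed.

Lemma sphere_p_compact (I : finType) (p : R) : 0 < p ->
  compact (@sphere_p I p).
Proof.
move=> p0.
have cK := @tychonoff I (fun=> R) (fun=> `[-1, 1]%classic)
  (fun=> @segment_compact R (-1) 1).
apply: (subclosed_compact _ cK).
- have -> : @sphere_p I p =
      (fun x : {ptws I -> R} => \sum_i `|x i| `^ p) @^-1` [set 1].
    by apply/seteqP; split=> x /= h; [apply/(pnorm_eq1 _ p0)|
      apply/(pnorm_eq1 x p0)].
  apply: preimage_closed; last exact: closed_eq.
  move=> a _.
  apply: (@cvg_sum_fin _ _ xpredT
    (fun i (x : {ptws I -> R}) => `|x i| `^ p)) => i _.
  apply: (@cvg_comp _ _ _ (fun x : {ptws I -> R} => x i)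
    (fun y : R => `|y| `^ p)); first exact: ptws_cvg.
  exact: cvg_norm_powR.
- move=> x /(proj1 (pnorm_eq1 _ p0)) S1 i /=.
  rewrite in_itv/= -ler_norml leNgt; apply/negP => x1.
  have := @gt0_ltr_powR R p p0 1 `|x i|.
  rewrite !nnegrE ler01 normr_ge0 powR1 => /(_ isT isT x1).
  rewrite ltNge => /negP; apply; rewrite -S1 (bigD1 i)//= lerDl.
  by apply: sumr_ge0 => j _; exact: powR_ge0.
Qed.

Lemma sphere_p_neq0 (I : finType) (i : I) (p : R) : 0 < p ->
  @sphere_p I p !=set0.
Proof.
move=> p0; exists (fun j => (j == i)%:R); apply/pnorm_eq1 => //.
rewrite (bigD1 i)//= eqxx normr1 powR1 big1 ?addr0// => j /negbTE ->.
by rewrite normr0 powR0 ?gt_eqF.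
Qed.

Variables (r s : nat) (G : dhypergraph r s).
Hypotheses (r0 : (0 < r)%N) (s0 : (0 < s)%N) (G0 : arcs G != finset.set0).
Variables (p q : R).
Hypotheses (p1 : 1 <= p) (q1 : 1 <= q).

Lemma polyform_max : exists x y, [/\ pnorm p x = 1, pnorm q y = 1 &
  forall x' y', pnorm p x' = 1 -> pnorm q y' = 1 ->
    polyform G x' y' <= polyform G x y].
Proof.
have p0 : 0 < p by exact: lt_le_trans p1.
have q0 : 0 < q by exact: lt_le_trans q1.
have [e eG] := finset.set0Pn _ G0.
have [_ er es] := arcsP eG.
have [u ue] : exists u, u \in e.1 by apply/finset.set0Pn; rewrite -card_gt0 er.
have [v ve] : exists v, v \in e.2 by apply/finset.set0Pn; rewrite -card_gt0 es.
have uT : u \in tails G by apply/bigcupP; exists e.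
have vH : v \in heads G by apply/bigcupP; exists e.
have [x0 hx0] := sphere_p_neq0 (Sub u uT : tail_vertex G) p0.
have [y0 hy0] := sphere_p_neq0 (Sub v vH : head_vertex G) q0.
pose A := @sphere_p (tail_vertex G) p `*` @sphere_p (head_vertex G) q.
pose Z := ({ptws tail_vertex G -> R} * {ptws head_vertex G -> R})%type.
pose f (z : Z) : R := polyform G z.1 z.2.
have [||| [x y] xy ub] := @compact_EVT_max _ R f A.
- by exists (x0, y0).
- by apply: compact_setX; exact: sphere_p_compact.
- apply: continuous_subspaceT => a.
  apply: (@cvg_sum_fin _ _ (fun d => d \in arcs G) (fun d (z : Z) =>
    (\prod_(u : tail_vertex G | val u \in d.1) z.1 u) *
    (\prod_(v : head_vertex G | val v \in d.2) z.2 v))) => d _.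
  pose g (z : Z) : R := \prod_(u : tail_vertex G | val u \in d.1) z.1 u.
  pose h (z : Z) : R := \prod_(v : head_vertex G | val v \in d.2) z.2 v.
  have cg : g z @[z --> a] --> g a.
    apply: (@cvg_prod_fin _ _ (fun u : tail_vertex G => val u \in d.1)
      (fun u (z : Z) => z.1 u)) => i _.
    apply: (@cvg_comp _ _ _ fst (fun x : {ptws tail_vertex G -> R} => x i)).
      exact: cvg_fst.
    exact: ptws_cvg.
  have ch : h z @[z --> a] --> h a.
    apply: (@cvg_prod_fin _ _ (fun v : head_vertex G => val v \in d.2)
      (fun v (z : Z) => z.2 v)) => i _.
    apply: (@cvg_comp _ _ _ snd (fun x : {ptws head_vertex G -> R} => x i)).
      exact: cvg_snd.
    exact: ptws_cvg.
  exact: (@cvgM R Z (nbhs a) _ g h (g a) (h a) cg ch).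
have [xs ys] := set_mem xy.
exists x, y; split => // x' y' x1 y1.
by apply: (ub (x', y')); apply/mem_set.
Qed.

Lemma lambda_attained : exists x y,
  [/\ pnorm p x = 1, pnorm q y = 1 & polyform G x y = lambda G p q].
Proof.
have [x [y [x1 y1 ub]]] := polyform_max.
exists x, y; split => //; apply/eqP; rewrite eq_le; apply/andP; split.
  apply: ub_le_sup; last by exists x, y.
  by exists (polyform G x y) => _ [x' [y' [? ? ->]]]; exact: ub.
apply: ge_sup; first by exists (polyform G x y); exists x, y.
by move=> _ [x' [y' [? ? ->]]]; exact: ub.
Qed.

Lemma lambda_ub x y : pnorm p x = 1 -> pnorm q y = 1 ->
  polyform G x y <= lambda G p q.
Proof.
move=> x1 y1; have [x' [y' [x1' y1' ub]]] := polyform_max.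
apply: ub_le_sup; last by exists x, y.
by exists (polyform G x' y') => _ [? [? [? ? ->]]]; exact: ub.
Qed.

End Attained.

(* Main.v *)
(* Convexity at [z = t x + (1 - t) y] follows from Hoelder's inequality. If     *)
(* [(a, b)] is a maximiser for [lambda (p z) (q z)] and [W e] is the monomial   *)
(* of the arc [e] at [(|a|, |b|)], then [lambda (p z) (q z) <= sum W], while    *)
(* [(|a| `^ (z / x), |b| `^ (z / x))] is admissible for [(p x, q x)], whence    *)
(* [sum (W `^ (z / x)) <= lambda (p x) (q x)], and likewise for [y]. Since      *)
(* [(t x / z) (z / x) + ((1 - t) y / z) (z / y) = 1], log-convexity of          *)
(* [k |-> sum (W `^ k)] concludes.                                              *)
Require Import Defs.
From mathcomp Require Import all_boot all_order all_algebra.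
From mathcomp Require Import all_classical all_reals all_analysis.
From mathcomp Require Import ring.
Set Implicit Arguments.
Unset Strict Implicit.
Unset Printing Implicit Defensive.
Import Order.TTheory GRing.Theory Num.Theory.
Local Open Scope classical_set_scope.
Local Open Scope ring_scope.

(** Raising the absolute values of a unit vector to the power [c] trades the norm exponent [c * p]
    for [p] and raises every arc monomial to the power [c] ([pnorm_normr_powR],
    [polyform_normr_powR]). A maximiser at one scale thus gives competitors at all others, and
    [sum_arc_monomial_powR_le_lambda] bounds the power sums of a single family of monomials by the
    values of [lambda]. Convexity is then inherited from these power sums ([ln_sum_powR_convex]);
    [lambda_gt0] ensures that every logarithm is taken of a positive number. *)

Lemma prod_powR (R : realType) (I : Type) (r : seq I) (P : pred I)
    (F : I -> R) (c : R) : (forall i, P i -> 0 <= F i) ->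
  \prod_(i <- r | P i) F i `^ c = (\prod_(i <- r | P i) F i) `^ c.
Proof.
move=> F0; pose K (a b : R) := 0 <= b /\ a = b `^ c.
suff [] : K (\prod_(i <- r | P i) F i `^ c) (\prod_(i <- r | P i) F i) by [].
apply: big_ind2 => [|a b a' b' [b0 ->] [b'0 ->]|i /F0 //].
  by split; rewrite ?powR1.
by split; rewrite ?mulr_ge0 ?powRM.
Qed.

Lemma sumr_gt0 (R : realType) (I : finType) (P : pred I) (F : I -> R) (i : I) :
  (forall j, P j -> 0 <= F j) -> P i -> 0 < F i -> 0 < \sum_(j | P j) F j.
Proof.
move=> F0 Pi Fi; rewrite (bigD1 i)//= ltr_wpDr//.
by apply: sumr_ge0 => j /andP[/F0].
Qed.

Lemma expR_convex_comb (R : realType) (a b u v : R) :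
  0 <= a -> 0 <= b -> a + b = 1 ->
  expR (a * u + b * v) <= a * expR u + b * expR v.
Proof.
move=> a0 b0 ab; have a1 : a <= 1 by rewrite -ab lerDl.
have -> : b = 1 - a by rewrite -ab addrC addKr.
by have := convex_expR (Itv01 a0 a1) u v; rewrite !convRE.
Qed.

(** Hoelder's inequality in logarithmic form: normalise both power sums to 1, apply weighted AM-GM
    to each term, and sum. *)
Lemma ln_sum_powR_convex (R : realType) (I : finType) (P : pred I) (W : I -> R)
    (i : I) (a b c d : R) :
  (forall j, P j -> 0 <= W j) -> P i -> 0 < W i ->
  0 <= a -> 0 <= b -> a + b = 1 -> 0 < c -> 0 < d ->
  ln (\sum_(j | P j) W j `^ (a * c + b * d)) <=
    a * ln (\sum_(j | P j) W j `^ c) + b * ln (\sum_(j | P j) W j `^ d).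
Proof.
move=> W0 Pi Wi a0 b0 ab c0 d0.
have S0 k : 0 < \sum_(j | P j) W j `^ k.
  by apply: (@sumr_gt0 _ _ _ _ i) => // [j _|]; rewrite ?powR_ge0 ?powR_gt0.
set A := \sum_(j | P j) W j `^ c; set B := \sum_(j | P j) W j `^ d.
have A0 : 0 < A by exact: S0.
have B0 : 0 < B by exact: S0.
rewrite -ler_expR lnK ?posrE//; set E := expR _.
have k0 : a * c + b * d != 0.
  move: a0 ab; rewrite le_eqVlt => /predU1P[<-|a0 ab].
    by rewrite add0r mul0r add0r => ->; rewrite mul1r gt_eqF.
  by rewrite gt_eqF// ltr_wpDr ?mulr_gt0// mulr_ge0// ltW.
(* [E] is [A]^ a * B [^ b]. Summing this termwise bound over [j] gives [E * (a + b) = E]. *)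
suff H j : P j ->
    W j `^ (a * c + b * d) <= E * (a * (W j `^ c / A) + b * (W j `^ d / B)).
  apply: le_trans (ler_sum _ H) _; rewrite -mulr_sumr big_split/=.
  rewrite -!mulr_sumr -!mulr_suml -/A -/B !divff ?gt_eqF//.
  by rewrite !mulr1 ab mulr1.
move=> Pj; have := W0 _ Pj; rewrite le_eqVlt => /predU1P[<-|Wj].
  by rewrite !powR0 ?(gt_eqF c0) ?(gt_eqF d0)// !mul0r !mulr0 addr0 mulr0.
have wE k C : 0 < C -> W j `^ k / C = expR (k * ln (W j) - ln C).
  move=> C0; rewrite expRD expRN lnK ?posrE//.
  by rewrite -ln_powR lnK// posrE powR_gt0.
rewrite !wE//.
apply: le_trans (ler_wpM2l (expR_ge0 _) (expR_convex_comb _ _ a0 b0 ab)).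
rewrite -expRD -[leLHS]lnK ?posrE ?powR_gt0// ln_powR ler_expR.
by rewrite le_eqVlt; apply/orP; left; apply/eqP; ring.
Qed.

Lemma pnorm_normr_powR (R : realType) (I : finType) (p c : R) (x : I -> R) :
  0 < p -> 0 < c -> pnorm (c * p) x = 1 ->
  pnorm p (fun i => `|x i| `^ c) = 1.
Proof.
move=> p0 c0 /(pnorm_eq1 _ (mulr_gt0 c0 p0)) h; apply/pnorm_eq1 => //.
by rewrite -h; apply: eq_bigr => i _; rewrite ger0_norm ?powR_ge0// powRrM.
Qed.

Lemma pnorm_cst (R : realType) (I : finType) (p : R) : 0 < p -> (0 < #|I|)%N ->
  pnorm p (fun _ : I => #|I|%:R^-1 `^ p^-1) = 1.
Proof.
move=> p0 I0; apply/pnorm_eq1 => //.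
under eq_bigr => i _ do
  rewrite ger0_norm ?powR_ge0// -powRrM mulVf ?gt_eqF// powRr1 ?invr_ge0//.
by rewrite sumr_const -[LHS]mulr_natl divff// pnatr_eq0 -lt0n.
Qed.

Section Monomial.
Variables (R : realType) (r s : nat) (G : dhypergraph r s).
Implicit Types (x : tail_vertex G -> R) (y : head_vertex G -> R).

(** Absolute values are taken because a maximiser may have negative entries, while real powers are
    multiplicative on nonnegative factors. *)
Definition arc_monomial x y (e : {set G} * {set G}) : R :=
  (\prod_(u : tail_vertex G | val u \in e.1) `|x u|) *
  (\prod_(v : head_vertex G | val v \in e.2) `|y v|).

Lemma arc_monomial_ge0 x y e : 0 <= arc_monomial x y e.
Proof. by rewrite mulr_ge0// prodr_ge0. Qed.

Lemma polyform_le_arc_monomial x y :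
  polyform G x y <= \sum_(e in arcs G) arc_monomial x y e.
Proof.
apply: ler_sum => e _; apply: le_trans (ler_norm _) _.
by rewrite normrM !normr_prod.
Qed.

Lemma polyform_normr_powR x y (c : R) :
  polyform G (fun u => `|x u| `^ c) (fun v => `|y v| `^ c) =
  \sum_(e in arcs G) arc_monomial x y e `^ c.
Proof.
apply: eq_bigr => e _.
by rewrite !prod_powR// -powRM// prodr_ge0.
Qed.

Hypotheses (r0 : (0 < r)%N) (s0 : (0 < s)%N) (G0 : arcs G != finset.set0).
Variables (p q : R).
Hypotheses (p1 : 1 <= p) (q1 : 1 <= q).

Lemma sum_arc_monomial_powR_le_lambda (c : R) x y : 0 < c ->
  pnorm (c * p) x = 1 -> pnorm (c * q) y = 1 ->
  \sum_(e in arcs G) arc_monomial x y e `^ c <= lambda G p q.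
Proof.
move=> c0 hx hy; rewrite -polyform_normr_powR.
have p0 : 0 < p by exact: lt_le_trans p1.
have q0 : 0 < q by exact: lt_le_trans q1.
by apply: lambda_ub => //; exact: pnorm_normr_powR.
Qed.

(** The constant unit vectors have positive entries, so every arc contributes a positive term. *)
Lemma lambda_gt0 : 0 < lambda G p q.
Proof.
have p0 : 0 < p by exact: lt_le_trans p1.
have q0 : 0 < q by exact: lt_le_trans q1.
have [e eG] := finset.set0Pn _ G0; have [_ er es] := arcsP eG.
have /card_gt0P[u ue] : (0 < #|e.1|)%N by rewrite er.
have /card_gt0P[v ve] : (0 < #|e.2|)%N by rewrite es.
have uT : u \in tails G by apply/bigcupP; exists e.
have vH : v \in heads G by apply/bigcupP; exists e.
have T0 : (0 < #|tail_vertex G|)%N.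
  by apply/card_gt0P; exists (Sub u uT : tail_vertex G).
have H0 : (0 < #|head_vertex G|)%N.
  by apply/card_gt0P; exists (Sub v vH : head_vertex G).
apply: lt_le_trans
  (lambda_ub r0 s0 G0 p1 q1 (pnorm_cst p0 T0) (pnorm_cst q0 H0)).
have pos (d : {set G} * {set G}) : 0 <
    (\prod_(w : tail_vertex G | val w \in d.1) #|tail_vertex G|%:R^-1 `^ p^-1) *
    (\prod_(w : head_vertex G | val w \in d.2) #|head_vertex G|%:R^-1 `^ q^-1)
    :> R.
  by rewrite mulr_gt0// prodr_gt0// => w _; rewrite powR_gt0// invr_gt0 ltr0n.
by apply: (sumr_gt0 (i := e)) => [d _||]; [exact/ltW/pos| |exact: pos].
Qed.

End Monomial.

(** Already [r / p < x], so [p * x > r >= 1]: the scaled exponents stay in the range where [lambda]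
    is attained. *)
Lemma mul_ge1_of_ratio_lt (R : realType) (r s : nat) (p q x : R) :
  (0 < r)%N -> 0 < p -> 0 < q -> r%:R / p + s%:R / q < x -> 1 <= p * x.
Proof.
move=> r0 p0 q0 hx; have : r%:R / p < x.
  by apply: le_lt_trans hx; rewrite lerDl divr_ge0// ltW.
rewrite ltr_pdivrMr// mulrC => /ltW; apply: le_trans.
by rewrite ler1n.
Qed.

Theorem theorem5p9 (R : realType) (r s : nat) (r_gt0 : (0 < r)%N)
    (s_gt0 : (0 < s)%N) (G : dhypergraph r s) (G_arc : arcs G != finset.set0)
    (p q : R) (p_ge1 : 1 <= p) (q_ge1 : 1 <= q)
    (hpq : r%:R / p + s%:R / q < 1) :
  convex_function (`]r%:R / p + s%:R / q, +oo[%classic : set R^o)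
    (fun x : R^o => x * ln (lambda G (p * x) (q * x))).
Proof.
move=> t x y /[!inE]/= /[!in_itv]/= /[!andbT] hx hy.
have p0 : 0 < p by exact: lt_le_trans p_ge1.
have q0 : 0 < q by exact: lt_le_trans q_ge1.
have px (w : R) : r%:R / p + s%:R / q < w -> 1 <= p * w.
  exact: mul_ge1_of_ratio_lt.
have qx (w : R) : r%:R / p + s%:R / q < w -> 1 <= q * w.
  by rewrite addrC; exact: mul_ge1_of_ratio_lt.
have pos (w : R) : r%:R / p + s%:R / q < w -> 0 < w.
  by move/px => h; rewrite -(pmulr_rgt0 w p0); exact: lt_le_trans h.
pose a : R := t%:num.
have [a0 a1] : 0 <= a /\ a <= 1 by rewrite /a.
have -> : conv t x y = a * x + (1 - a) * y :> R by [].
rewrite [leRHS](_ : _ = a * (x * ln (lambda G (p * x) (q * x))) +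
  (1 - a) * (y * ln (lambda G (p * y) (q * y)))); last by [].
set z := a * x + _.
have hz : r%:R / p + s%:R / q < z.
  rewrite -subr_gt0 [ltRHS](_ : _ = a * (x - (r%:R / p + s%:R / q)) +
    (1 - a) * (y - (r%:R / p + s%:R / q))); last by rewrite /z; ring.
  move: a0; rewrite le_eqVlt => /predU1P[<-|a0].
    by rewrite mul0r add0r subr0 mul1r subr_gt0.
  by rewrite ltr_wpDr ?mulr_gt0 ?mulr_ge0 ?subr_gt0 ?subr_ge0// ltW.
have [x0 y0 z0] := And3 (pos _ hx) (pos _ hy) (pos _ hz).
have [f [g [f1 g1 fg]]] := lambda_attained r_gt0 s_gt0 G_arc (px _ hz) (qx _ hz).
set W := arc_monomial f g.
have W0 e : e \in arcs G -> 0 <= W e by move=> _; exact: arc_monomial_ge0.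
have lW : lambda G (p * z) (q * z) <= \sum_(e in arcs G) W e.
  by rewrite -fg; exact: polyform_le_arc_monomial.
have lz := lambda_gt0 r_gt0 s_gt0 G_arc (px _ hz) (qx _ hz).
(* [W] has a positive sum, hence a positive term, which keeps all its power sums positive. *)
have [e eG We] : exists2 e, e \in arcs G & 0 < W e.
  have := lt_le_trans lz lW; rewrite lt_neqAle => /andP[+ _].
  rewrite eq_sym psumr_neq0// => /hasP[e _ /andP[eG We]].
  by exists e.
(* The power [z / w] moves the maximiser from the norms [p * z], [q * z] to [p * w], [q * w]. *)
have Wl (w : R) : r%:R / p + s%:R / q < w ->
    ln (\sum_(e in arcs G) W e `^ (z / w)) <= ln (lambda G (p * w) (q * w)).
  move=> hw; have w0 := pos _ hw.
  rewrite ler_ln ?posrE; last first.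
  - exact: (lambda_gt0 r_gt0 s_gt0 G_arc (px _ hw) (qx _ hw)).
  - apply: (sumr_gt0 (i := e)) => // [j _|]; first exact: powR_ge0.
    exact: powR_gt0.
  apply: (sum_arc_monomial_powR_le_lambda r_gt0 s_gt0 G_arc (px _ hw) (qx _ hw)).
  + exact: divr_gt0.
  + by rewrite (_ : z / w * _ = p * z)//; field; rewrite gt_eqF.
  + by rewrite (_ : z / w * _ = q * z)//; field; rewrite gt_eqF.
have zn0 : z != 0 by rewrite gt_eqF.
(* These weights sum to 1 by the definition of [z], and they average the exponents [z / x] and
   [z / y] to [a + (1 - a) = 1], which recovers the plain sum of [W]. *)
have := @ln_sum_powR_convex R _ (mem (arcs G)) W e (a * x / z)
  ((1 - a) * y / z) (z / x) (z / y) W0 eG We.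
have -> : a * x / z * (z / x) + (1 - a) * y / z * (z / y) = 1.
  by field; rewrite zn0 !gt_eqF.
under eq_bigr => d dG do rewrite powRr1 ?W0//.
have b0 : 0 <= 1 - a by rewrite subr_ge0.
move=> /(_ _ _ _ _ _)/le_trans H.
apply: (@le_trans _ _ (z * ln (\sum_(d in arcs G) W d))).
  by rewrite ler_pM2l// ler_ln// posrE// (lt_le_trans lz).
rewrite -ler_pdivlMl//; apply: H.
- by rewrite !mulr_ge0// ?invr_ge0 ltW.
- by rewrite !mulr_ge0// ?invr_ge0 ltW.
- by rewrite -mulrDl divff.
- exact: divr_gt0.
- exact: divr_gt0.
(* After cancelling [z^-1], each summand is an instance of [Wl], at [x] and at [y]. *)
rewrite mulrDr; apply: lerD;
  rewrite (mulrC _ z^-1) -!mulrA ler_pM2l ?invr_gt0//;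
  by apply: ler_wpM2l => //; rewrite ler_pM2l// Wl.
Qed.
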